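(* Let $k\ge 1$, let $\bar{Y}_1,\dots,\bar{Y}_k$ be real numbers and $n_1,\dots,n_k$ positive integers. For each $i\in[1,k]$, the SDMMSA estimator and the PAVA estimator computed from $\{(\bar{Y}_i,n_i)\}_{i=1}^k$ coincide: $$\hat{\mu}_i(\bar{Y}_1,\dots,\bar{Y}_k)=\hat{\mu}_i^{pava}(\bar{Y}_1,\dots,\bar{Y}_k),$$ whichever violating pairs are picked in the course of the PAVA.
   Context: Integer intervals: $[a,b]$ denotes the set of integers from $a$ to $b$. For $1\le i\le j\le k$ put $n_{i,j}=\sum_{h=i}^j n_h$ and $\bar{Y}_{i,j}=\frac{1}{n_{i,j}}\sum_{h=i}^j n_h\bar{Y}_h$. SDMMSA (step-down maximum mean selection algorithm): set $i_0=k+1$. Given $i_{u-1}>1$, let $i_u$ be the smallest $j\in[1,i_{u-1}-1]$ such that $\bar{Y}_{j,i_{u-1}-1}=\max_{1\le j'\le i_{u-1}-1}\bar{Y}_{j',i_{u-1}-1}$, and define $\hat{\mu}_i=\bar{Y}_{i_u,i_{u-1}-1}$ for all $i\in[i_u,i_{u-1}-1]$. Stop at the first $u=h$ with $i_h=1$. This defines $\hat{\mu}_i=\hat{\mu}_i(\bar{Y}_1,\dots,\bar{Y}_k)$ for every $i\in[1,k]$. PAVA (pooled adjacent violator algorithm): start with $a_i=\bar{Y}_i$, $i\in[1,k]$. If $a_1\le\cdots\le a_k$, stop and set $\hat{\mu}_i^{pava}=a_i$ for all $i$. Otherwise pick any $j$ with $a_j>a_{j+1}$; let $j_l$ be the smallest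 integer such that $a_i=a_j$ for all $i\in[j_l,j]$, and let $j_u$ be the largest integer such that $a_i=a_{j+1}$ for all $i\in[j+1,j_u]$. For each $i\in[j_l,j_u]$ replace $a_i$ by the weighted average $\left(\sum_{v=j_l}^{j_u}n_va_v\right)/\left(\sum_{v=j_l}^{j_u}n_v\right)$, leave the other $a_i$ unchanged, and repeat with the new data $\{(a_i,n_i)\}_{i=1}^k$. The procedure stops after finitely many steps. *)

(* Defs.v *)
From HB Require Import structures.
From mathcomp Require Import all_boot all_order all_algebra.
From mathcomp Require Import reals.

Set Implicit Arguments.
Unset Strict Implicit.
Unset Printing Implicit Defensive.

Import Order.TTheory GRing.Theory Num.Theory.
Local Open Scope ring_scope.

(* Indices are shifted by one: the data Y_1, ..., Y_k and n_1, ..., n_k are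
   functions on 'I_k = {0, ..., k - 1}. *)

Section Estimators.
Context (R : realType) (k : nat) (n : 'I_k -> nat).
Implicit Types (Y a b : 'I_k -> R).

(* The endpoints are natural numbers, so that they may also be the (shifted)
   cut points of the step-down algorithm, which range over [0, k]. *)
Definition wavg Y (i j : nat) : R :=
  (\sum_(h < k | (i <= h <= j)%N) (n h)%:R * Y h)
    / (\sum_(h < k | (i <= h <= j)%N) n h)%N%:R.

Definition is_argmax Y (m j : nat) : bool :=
  all (fun j' => wavg Y j' m.-1 <= wavg Y j m.-1) (iota 0 m).

(* The smallest j < m at which wavg Y j (m - 1) is maximal; the position found
   in iota 0 m is the element itself.  By convention sd_next Y 0 = 0. *)
Definition sd_next Y (m : nat) : nat := find (is_argmax Y m) (iota 0 m).

(* sd_cut Y u is i_u - 1: it starts at k, strictly decreases until it reaches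
   0 (the algorithm stops there), and is constant afterwards. *)
Definition sd_cut Y (u : nat) : nat := iter u (sd_next Y) k.

Lemma sd_next_argmax Y m : (0 < m)%N ->
  [/\ (sd_next Y m < m)%N, is_argmax Y m (sd_next Y m)
    & forall j, (j < sd_next Y m)%N -> ~~ is_argmax Y m j].
Proof.
move=> m_gt0.
have hasmax : has (is_argmax Y m) (iota 0 m).
  pose F (j : 'I_m) := wavg Y j m.-1.
  have [j _ jmax] := @arg_maxP _ R _ (Ordinal m_gt0) xpredT F isT.
  apply/hasP; exists (j : nat); first by rewrite mem_iota add0n ltn_ord.
  apply/allP => j'; rewrite mem_iota add0n /= => lt_j'm.
  exact: (jmax (Ordinal lt_j'm)).
have lt_next : (sd_next Y m < m)%N.
  by rewrite /sd_next -[X in (_ < X)%N](size_iota 0 m) -has_find.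
split=> //.
  by have := nth_find 0%N hasmax; rewrite nth_iota.
move=> j lt_j; have := before_find 0%N lt_j.
by rewrite nth_iota ?add0n ?(ltn_trans lt_j) // => ->.
Qed.

Lemma sd_cut_le Y u : (sd_cut Y u <= k - u)%N.
Proof.
elim: u => [|u IHu]; first by rewrite subn0.
rewrite /sd_cut iterS -/(sd_cut Y u).
have [->|cut_gt0] := posnP (sd_cut Y u); first by [].
have [lt_next _ _] := sd_next_argmax Y cut_gt0.
by rewrite subnS -ltnS (leq_trans lt_next) // (leq_trans IHu) // leqSpred.
Qed.

Lemma sd_cut_reaches Y (i : 'I_k) : exists u, (sd_cut Y u <= i)%N.
Proof. by exists k; rewrite (leq_trans (sd_cut_le Y k)) // subnn. Qed.

(* With u the first step such that i_u <= i, the index i belongs to the block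
   [i_u, i_(u-1) - 1]; see sdmmsaE. *)
Definition sdmmsa Y (i : 'I_k) : R :=
  let u := ex_minn (sd_cut_reaches Y i) in
  wavg Y (sd_cut Y u) (sd_cut Y u.-1).-1.

Lemma sd_cut_mono Y u v : (u <= v)%N -> (sd_cut Y v <= sd_cut Y u)%N.
Proof.
move=> /subnK <-; elim: (v - u)%N => // d IHd.
rewrite addSn /sd_cut iterS -/(sd_cut Y (d + u)); apply: leq_trans IHd.
have [->//|cut_gt0] := posnP (sd_cut Y (d + u)).
by have [/ltnW] := sd_next_argmax Y cut_gt0.
Qed.

Lemma sdmmsaE Y u (i : 'I_k) : (sd_cut Y u.+1 <= i < sd_cut Y u)%N ->
  sdmmsa Y i = wavg Y (sd_cut Y u.+1) (sd_cut Y u).-1.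
Proof.
move=> /andP[le_i lt_i]; rewrite /sdmmsa; case: ex_minnP => v le_v min_v.
suff -> : v = u.+1 by [].
apply/eqP; rewrite eqn_leq min_v //= ltnNge; apply/negP => le_vu.
by have := leq_trans lt_i (leq_trans (sd_cut_mono Y le_vu) le_v); rewrite ltnn.
Qed.

Definition pool a (jl ju : 'I_k) : 'I_k -> R :=
  fun i => if (jl <= i <= ju)%N then wavg a jl ju else a i.

(* The violating pair is (j, j'), where j' is j + 1. *)
Definition pava_step a b : Prop :=
  exists j j' jl ju : 'I_k,
  [/\ j' = j.+1 :> nat /\ a j' < a j,
      (jl <= j)%N /\ (forall i : 'I_k, (jl <= i <= j)%N -> a i = a j),
      forall l : 'I_k, (l <= j)%N ->
        (forall i : 'I_k, (l <= i <= j)%N -> a i = a j) -> (jl <= l)%N,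
      (j' <= ju)%N /\ (forall i : 'I_k, (j' <= i <= ju)%N -> a i = a j') /\
      (forall l : 'I_k, (j' <= l)%N ->
        (forall i : 'I_k, (j' <= i <= l)%N -> a i = a j') -> (l <= ju)%N)
    & b =1 pool a jl ju].

(* pava a b: started from the data (a, n), some sequence of picks makes the
   pooling algorithm stop with output b. *)
Inductive pava a : ('I_k -> R) -> Prop :=
| pava_stop : {homo a : i j / (i <= j)%N >-> i <= j} -> pava a a
| pava_pick a' b : pava_step a a' -> pava a' b -> pava a b.

(* Every step decreases the number of indices i with a_i <> a_(i+1). *)
Definition jumps a : nat :=
  #|[set p : 'I_k * 'I_k | (p.2 == p.1.+1 :> nat) && (a p.1 != a p.2)]|.

Lemma pava_step_jumps a b : pava_step a b -> (jumps b < jumps a)%N.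
Proof.
move=> [j [j' [jl [ju [[j'E lt_a] [le_jl jlP] jl_min [le_ju [juP ju_max]] bE]]]]].
apply/proper_card/properP; split; last first.
  exists (j, j'); rewrite !inE /= j'E eqxx /=; first by rewrite gt_eqF.
  rewrite negbK !bE /pool le_jl j'E (leq_trans _ le_ju) ?j'E //=.
  by rewrite -j'E le_ju (leq_trans le_jl) // j'E.
apply/subsetP => -[p q]; rewrite !inE /= => /andP[/eqP qE]; rewrite qE eqxx /=.
apply: contraNneq => apq; rewrite !bE /pool qE.
case: (ltngtP p.+1 jl) => [lt_pjl|lt_jlp|p_jl].
- by rewrite leqNgt (ltn_trans _ lt_pjl) //= apq.
- rewrite -ltnS lt_jlp /=.
  case: (ltngtP p ju) => [lt_p|lt_p|p_ju] //; first by rewrite apq.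
  exfalso; suff : (q <= ju)%N by rewrite qE p_ju ltnn.
  have le_j'p : (j' <= p)%N by rewrite p_ju.
  apply: ju_max => [|i /andP[le_i]]; first by rewrite qE leqW.
  rewrite leq_eqVlt => /orP[/eqP/val_inj ->|].
    by rewrite -apq; apply: juP; rewrite le_j'p p_ju leqnn.
  by rewrite qE ltnS p_ju => le_i'; apply: juP; rewrite le_i.
- exfalso; suff : (jl <= p)%N by rewrite -p_jl ltnn.
  have lt_pj : (p < j)%N by rewrite p_jl.
  apply: jl_min => [|i /andP[]]; first exact: ltnW.
  rewrite leq_eqVlt => /orP[/eqP/val_inj <- _|].
    by rewrite apq; apply: jlP; rewrite qE p_jl leqnn.
  by rewrite p_jl => le_i i_le; apply: jlP; rewrite le_i.
Qed.

(* No sequence of picks goes on forever. *)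
Lemma pava_step_wf : well_founded (fun b a => pava_step a b).
Proof.
move=> a; move: {2}(jumps a).+1 (ltnSn (jumps a)) => m.
elim: m a => [a|m IHm a le_a]; first by rewrite ltn0.
apply: Acc_intro => b /pava_step_jumps lt_b.
by apply: IHm; exact: leq_trans lt_b _.
Qed.

Lemma pava_progress a :
  {homo a : i j / (i <= j)%N >-> i <= j} \/ exists b, pava_step a b.
Proof.
case: (boolP [exists j : 'I_k, exists j' : 'I_k,
    (j' == j.+1 :> nat) && (a j' < a j)]) => [/existsP[j /existsP[j']]|noviol].
  move=> /andP[/eqP j'E lt_a]; right.
  pose Pl (l : 'I_k) := ((l <= j)%N) && [forall i : 'I_k, (l <= i <= j)%N ==> (a i == a j)].
  pose Pu (l : 'I_k) := ((j' <= l)%N) &&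
    [forall i : 'I_k, (j' <= i <= l)%N ==> (a i == a j')].
  have Plj : Pl j.
    rewrite /Pl leqnn; apply/forallP => i; apply/implyP.
    by rewrite -eqn_leq => /eqP/val_inj ->.
  have Puj : Pu j'.
    rewrite /Pu leqnn; apply/forallP => i; apply/implyP.
    by rewrite -eqn_leq => /eqP/val_inj ->.
  case: (arg_minnP val Plj) => jl /andP[le_jl /forallP jlP] jl_min.
  case: (arg_maxnP val Puj) => ju /andP[le_ju /forallP juP] ju_max.
  exists (pool a jl ju); exists j, j', jl, ju; split=> //.
  - by split=> // i le_i; apply/eqP/(implyP (jlP i)).
  - move=> l le_l lP; apply: jl_min; rewrite /Pl le_l; apply/forallP => i.
    by apply/implyP => /lP ->.
  - split=> //; split=> [i le_i|l le_l lP]; first exact/eqP/(implyP (juP i)).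
    apply: ju_max; rewrite /Pu le_l; apply/forallP => i.
    by apply/implyP => /lP ->.
left=> i j le_ij; have [d] := ubnP (j - i)%N.
elim: d j le_ij => // d IHd j; rewrite leq_eqVlt => /orP[/eqP/val_inj -> //|].
case: j => -[//|j] lt_j /= lt_ij lt_d.
have lt_j' : (j < k)%N by exact: ltnW.
apply: (@le_trans _ _ (a (Ordinal lt_j'))).
  by apply: IHd => //=; rewrite -ltnS -subSn.
rewrite leNgt; apply: contra noviol => viol.
by apply/existsP; exists (Ordinal lt_j'); apply/existsP; exists (Ordinal lt_j); rewrite /= eqxx.
Qed.

Lemma pava_total a : exists b, pava a b.
Proof.
elim/(well_founded_ind pava_step_wf): a => a IHa.
have [homo_a|[b ab]] := pava_progress a; first by exists a; exact: pava_stop.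
by have [c bc] := IHa b ab; exists c; exact: pava_pick ab bc.
Qed.

End Estimators.

(* Main.v *)
Require Import Defs.
From mathcomp Require Import all_boot all_order all_algebra.
From mathcomp Require Import reals.
From mathcomp Require Import ring.

(** Both algorithms compute the slopes of the greatest convex minorant of the
    cumulative sums [psum Y m], that is, of the sum of [n_h * Y_h] over [h < m],
    plotted against the cumulative weight.

    For the pooling algorithm this rests on an invariant.  Every intermediate vector
    [a] has cumulative sums below those of [Y], with equality at [k] and wherever
    [a] jumps ([touching_minorant]).  Pooling a block on which [a] is
    nonincreasing replaces a concave piece of the cumulative graph by its chord:
    this lowers the graph ([psum_pool_le]), does not change it outside the block
    ([psum_pool_outside]), and creates no jump.  When the algorithm stops, [a] is
    in addition nondecreasing, so that its cumulative graph is convex.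

    For the step-down algorithm, let [f] be such a final vector, and let the graphs
    of [f] and [Y] meet at [p + 1].  The average of [Y] over [q, p] is a chord
    slope of the graph of [Y]; multiplied by the weight of [q, p], its shortfall
    from [f p] is the sum of two nonnegative amounts: the gap between the graphs
    at [q], and the weighted deviation of [f] from [f p] on [q, p]
    ([wavg_shortfall]).  Both vanish when [q] starts the level
    set of [f] containing [p], so the largest average is [f p]; and at any
    maximizer [q] both vanish, so that [f] is constant on [q, p] with the maximal
    average as value, and the graphs meet again at [q] ([argmax_level]).
    Iterating from [k] downwards shows that the estimator is [f]. *)

Set Implicit Arguments.
Unset Strict Implicit.
Unset Printing Implicit Defensive.

Import Order.TTheory GRing.Theory Num.Theory.
Local Open Scope ring_scope.

Section Isotonic.
Context (R : realType) (k : nat) (n : 'I_k -> nat).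
Hypothesis n_gt0 : forall i, (0 < n i)%N.
Implicit Types (Y a b c f : 'I_k -> R) (m : nat).

(** * Cumulative sums and block averages *)

Definition psum c m : R := \sum_(h < k | (h < m)%N) (n h)%:R * c h.

Definition weight (i j : nat) : R := \sum_(h < k | (i <= h <= j)%N) (n h)%:R.

Lemma psum0 c : psum c 0 = 0.
Proof. by rewrite /psum big_pred0. Qed.

Lemma weight_gt0 (i j : 'I_k) : (i <= j)%N -> 0 < weight i j.
Proof.
move=> le_ij; rewrite /weight (bigD1 j) /=; last by rewrite le_ij leqnn.
by apply: ltr_wpDr; [apply: sumr_ge0 | rewrite ltr0n].
Qed.

Lemma wavg_weight c (i j : 'I_k) : (i <= j)%N ->
  wavg n c i j * weight i j = \sum_(h < k | (i <= h <= j)%N) (n h)%:R * c h.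
Proof.
move=> le_ij; rewrite /wavg natr_sum -/(weight i j) divfK //.
by rewrite gt_eqF // weight_gt0.
Qed.

Lemma psum_block c (i j : nat) : (i <= j)%N ->
  psum c j.+1 = psum c i + \sum_(h < k | (i <= h <= j)%N) (n h)%:R * c h.
Proof.
move=> le_ij; rewrite /psum (bigID (fun h : 'I_k => (h < i)%N)) /=.
congr (_ + _); apply: eq_bigl => h; last by rewrite -leqNgt ltnS andbC.
by rewrite ltnS; case: (ltnP h i) => [lt_hi|]; rewrite ?andbF // (leq_trans (ltnW lt_hi)).
Qed.

Lemma psum_total c m :
  psum c k = psum c m + \sum_(h < k | ~~ (h < m)%N) (n h)%:R * c h.
Proof.
rewrite /psum (eq_bigl xpredT) => [|h]; last by rewrite ltn_ord.
by rewrite (bigID (fun h : 'I_k => (h < m)%N)).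
Qed.

(** * Pooling *)

Lemma psum_pool_outside a (jl ju : 'I_k) m : (jl <= ju)%N ->
  (m <= jl)%N || (ju < m)%N -> psum (pool n a jl ju) m = psum a m.
Proof.
move=> le_lu /orP[le_m|lt_m].
  apply: eq_bigr => h lt_hm; rewrite /pool leqNgt.
  by rewrite (leq_trans lt_hm le_m).
have blockE h : (h < m)%N && (jl <= h <= ju)%N = (jl <= h <= ju)%N.
  by rewrite andb_idl // => /andP[_ le_h]; exact: leq_ltn_trans lt_m.
rewrite /psum !(bigID (fun h : 'I_k => (jl <= h <= ju)%N) (fun h => (h < m)%N)) /=.
congr (_ + _); last by apply: eq_bigr => h /andP[_ /negbTE]; rewrite /pool => ->.
rewrite !(eq_bigl _ _ (fun h : 'I_k => blockE h)) -(wavg_weight a) // mulr_sumr.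
by apply: eq_bigr => h; rewrite /pool mulrC => ->.
Qed.

(** As long as the values met in the block are at least its average, replacing
    them by the average decreases the cumulative sum; once a smaller value has
    been met, all the remaining ones are smaller too, and the same comparison
    applies to the tail sum, the total being unchanged. *)
Lemma psum_pool_le a (jl ju : 'I_k) m : (jl <= ju)%N ->
  (forall h h' : 'I_k, (jl <= h)%N -> (h <= h')%N -> (h' <= ju)%N -> a h' <= a h) ->
  psum (pool n a jl ju) m <= psum a m.
Proof.
move=> le_lu anti_a; set w := wavg n a jl ju.
case: (boolP [forall h : 'I_k, (jl <= h <= ju)%N && (h < m)%N ==> (w <= a h)]).
  move=> /forallP ge_w; apply: ler_sum => h lt_hm; apply: ler_wpM2l => //.
  rewrite /pool; case: ifP => // inb.
  by have := ge_w h; rewrite inb lt_hm.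
rewrite negb_forall => /existsP[h0]; rewrite negb_imply -ltNge.
move=> /andP[/andP[/andP[le_lh0 le_h0u] lt_h0m] lt_w].
have := psum_pool_outside a (m := k) le_lu.
rewrite ltn_ord orbT (psum_total _ m) (psum_total a m) => /(_ isT) eq_tot.
rewrite -(lerD2r (\sum_(h < k | ~~ (h < m)%N) (n h)%:R * a h)) -eq_tot lerD2l.
apply: ler_sum => h; rewrite -leqNgt => le_mh; apply: ler_wpM2l => //.
rewrite /pool; case: ifP => // /andP[_ le_hu].
apply: le_trans (ltW lt_w); apply: anti_a => //.
exact: leq_trans (ltnW lt_h0m) le_mh.
Qed.

(** Convexity is left out because only the final vector has it: for [a]
    nondecreasing, this says that [a] is the slope of the greatest convex minorant. *)
Definition touching_minorant Y a : Prop :=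
  [/\ forall m, psum a m <= psum Y m,
      psum a k = psum Y k
    & forall p q : 'I_k, q = p.+1 :> nat -> a p != a q -> psum a q = psum Y q].

Lemma touching_minorant_refl Y : touching_minorant Y Y.
Proof. by split. Qed.

Lemma pava_step_touching Y a b :
  pava_step n a b -> touching_minorant Y a -> touching_minorant Y b.
Proof.
move=> [j [j' [jl [ju [[j'E lt_a] [le_jl jlP] jl_min [le_ju [juP ju_max]] bE]]]]].
move=> [le_aY eq_aY touch_a].
have le_lu : (jl <= ju)%N by rewrite (leq_trans le_jl) // ltnW // -j'E.
have psum_b m : psum b m = psum (pool n a jl ju) m.
  by apply: eq_bigr => h _; rewrite bE.
have anti_a (h h' : 'I_k) :
    (jl <= h)%N -> (h <= h')%N -> (h' <= ju)%N -> a h' <= a h.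
  move=> le_lh le_hh' le_h'u.
  have [le_hj|lt_jh] := leqP h j; last first.
    by rewrite !juP // j'E ?lt_jh ?(leq_trans lt_jh le_hh') ?(leq_trans le_hh').
  rewrite (jlP h) ?le_lh //.
  have [le_h'j|lt_jh'] := leqP h' j; first by rewrite jlP // (leq_trans le_lh).
  by rewrite juP ?ltW // j'E lt_jh'.
split=> [m||p q qE].
- by rewrite psum_b; apply: le_trans (le_aY m); exact: psum_pool_le.
- by rewrite psum_b psum_pool_outside // ltn_ord orbT.
rewrite !bE => jump_b; rewrite psum_b.
have out_q : (q <= jl)%N || (ju < q)%N.
  apply: contraNT jump_b; rewrite negb_or -ltnNge -leqNgt => /andP[lt_lq le_qu].
  by rewrite /pool (ltnW lt_lq) le_qu -ltnS -qE lt_lq ltnW // -qE.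
rewrite psum_pool_outside //; apply: (touch_a p) => //.
(* A jump of the pooled vector is at an end of the block or outside it; the
   ends are jumps of [a], the level sets being extended as far as possible. *)
apply: contraNneq jump_b => eq_a.
have [lt_pl|le_lp] := ltnP p jl.
  have [lt_ql|le_lq] := ltnP q jl.
    by rewrite /pool leqNgt lt_pl /= leqNgt lt_ql /= eq_a.
  have q_jl : q = jl by apply/val_inj/eqP; rewrite /= eqn_leq le_lq andbT qE.
  suff : (jl <= p)%N by rewrite leqNgt lt_pl.
  have lt_pj : (p < j)%N by rewrite (leq_trans lt_pl).
  apply: jl_min => [|i /andP[]]; first exact: ltnW.
  rewrite leq_eqVlt => /orP[/eqP/val_inj <- _|].
    by rewrite eq_a q_jl jlP // leqnn.
  by rewrite -qE q_jl => le_i i_le; apply: jlP; rewrite le_i.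
have lt_lq : (jl < q)%N by rewrite qE.
move: out_q; rewrite leqNgt lt_lq /= => lt_uq.
have [le_pu|lt_up] := leqP p ju; last first.
  by rewrite /pool [(p <= _)%N]leqNgt lt_up [(q <= _)%N]leqNgt lt_uq !andbF eq_a.
have p_ju : p = ju by apply/val_inj/eqP; rewrite /= eqn_leq le_pu -ltnS -qE.
suff : (q <= ju)%N by rewrite leqNgt lt_uq.
apply: ju_max => [|i /andP[le_i]]; first by rewrite qE p_ju leqW.
rewrite leq_eqVlt => /orP[/eqP/val_inj ->|].
  by rewrite -eq_a p_ju juP // le_ju leqnn.
by rewrite qE ltnS p_ju => le_i'; apply: juP; rewrite le_i.
Qed.

Lemma pava_touching Y a f : pava n a f -> touching_minorant Y a ->
  touching_minorant Y f /\ {homo f : i j / (i <= j)%N >-> i <= j}.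
Proof.
elim=> [{}a homo_a|{}a a' b step _ IH] touch_a; first by [].
by apply: IH; exact: pava_step_touching step touch_a.
Qed.

(** * Maximal averages against the convex minorant *)

Section ConvexMinorant.
Context (Y f : 'I_k -> R).
Hypothesis touch_f : touching_minorant Y f.
Hypothesis homo_f : {homo f : i j / (i <= j)%N >-> i <= j}.

(** Since the graphs meet at [p + 1], the block sums of [Y] and [f] over [q, p]
    differ by the gap at [q] alone. *)
Lemma wavg_shortfall (q p : 'I_k) : (q <= p)%N -> psum f p.+1 = psum Y p.+1 ->
  (f p - wavg n Y q p) * weight q p =
  (psum Y q - psum f q) + \sum_(h < k | (q <= h <= p)%N) (n h)%:R * (f p - f h).
Proof.
move=> le_qp; rewrite !(psum_block _ le_qp) => eq_p.
under eq_bigr do rewrite mulrBr.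
rewrite sumrB -mulr_suml -/(weight q p) mulrBl wavg_weight //.
have -> : \sum_(h < k | (q <= h <= p)%N) (n h)%:R * Y h =
  psum f q + \sum_(h < k | (q <= h <= p)%N) (n h)%:R * f h - psum Y q.
  by rewrite eq_p; ring.
ring.
Qed.

(** At the start of a level set either [q = 0] or [f] jumps, so the graphs meet
    and neither term of the shortfall remains. *)
Lemma level_start (p : 'I_k) : psum f p.+1 = psum Y p.+1 ->
  exists2 q : 'I_k, (q <= p)%N & wavg n Y q p = f p.
Proof.
move=> eq_p; case: (@arg_minnP _ p (fun q => f q == f p) val (eqxx _)).
move=> q /eqP fq q_min; have le_qp := q_min p (eqxx _).
exists q => //.
have eq_q : psum f q = psum Y q.
  have [-> | q_gt0] := posnP q; first by rewrite !psum0.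
  have lt_q : (q.-1 < k)%N by rewrite (leq_ltn_trans (leq_pred q)).
  have [_ _ /(_ (Ordinal lt_q) q)] := touch_f; apply; first by rewrite /= prednK.
  apply/negP; rewrite fq => /q_min /=.
  by rewrite -ltnS prednK // ltnn.
apply/esym/eqP; rewrite -subr_eq0.
rewrite -(mulIr_eq0 _ (mulIf (lt0r_neq0 (weight_gt0 le_qp)))).
rewrite wavg_shortfall // eq_q subrr add0r big1 // => h /andP[le_qh le_hp].
suff -> : f h = f p by rewrite subrr mulr0.
by apply/eqP; rewrite eq_le homo_f //= -fq homo_f.
Qed.

(** The maximal average is at least [f p] by [level_start], so the shortfall at
    a maximizer is at most [0], while it is a sum of nonnegative terms: all of
    them vanish. *)
Lemma argmax_level (q p : 'I_k) :
  (q <= p)%N -> psum f p.+1 = psum Y p.+1 -> is_argmax n Y p.+1 q ->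
  [/\ psum f q = psum Y q, wavg n Y q p = f p
    & forall i : 'I_k, (q <= i <= p)%N -> f i = f p].
Proof.
move=> le_qp eq_p /allP qmax.
have ge_fp : f p <= wavg n Y q p.
  have [q0 le_q0p <-] := level_start eq_p.
  by apply: (qmax q0); rewrite mem_iota /= add0n ltnS.
have gap_ge0 : 0 <= psum Y q - psum f q by rewrite subr_ge0; case: touch_f.
have dev_ge0 (h : 'I_k) : (q <= h <= p)%N -> 0 <= (n h)%:R * (f p - f h).
  by move=> /andP[_ le_hp]; rewrite mulr_ge0 // subr_ge0 homo_f.
have sum_ge0 := sumr_ge0 (index_enum 'I_k) dev_ge0.
have short := wavg_shortfall le_qp eq_p.
have W_gt0 := weight_gt0 le_qp.
have short_le0 : (f p - wavg n Y q p) * weight q p <= 0.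
  by rewrite pmulr_lle0 // subr_le0.
rewrite short in short_le0.
have /eqP := le_anti (introT andP (conj short_le0 (addr_ge0 gap_ge0 sum_ge0))).
rewrite paddr_eq0 // => /andP[/eqP gap0 /eqP sum0].
split=> [||i le_i].
- by apply/esym/eqP; rewrite -subr_eq0 gap0.
- move: short; rewrite gap0 sum0 addr0 => /eqP.
  by rewrite mulf_eq0 (gt_eqF W_gt0) orbF subr_eq0 => /eqP.
move/eqP: sum0; rewrite psumr_eq0 // => /allP/(_ i (mem_index_enum _)).
rewrite le_i /= mulf_eq0 pnatr_eq0 eqn0Ngt n_gt0 subr_eq0.
by move=> /eqP.
Qed.

Lemma sd_next_level m : (0 < m <= k)%N -> psum f m = psum Y m ->
  psum f (sd_next n Y m) = psum Y (sd_next n Y m) /\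
  forall i : 'I_k, (sd_next n Y m <= i < m)%N ->
    f i = wavg n Y (sd_next n Y m) m.-1.
Proof.
case: m => // m lt_mk eq_m.
have [lt_next qmax _] := sd_next_argmax n Y (ltn0Sn m).
have lt_qk := leq_trans lt_next lt_mk.
have [] := @argmax_level (Ordinal lt_qk) (Ordinal lt_mk) lt_next eq_m qmax.
by move=> eq_q /= -> level; split.
Qed.

Lemma psum_sd_cut u : psum f (sd_cut n Y u) = psum Y (sd_cut n Y u).
Proof.
elim: u => [|u IHu]; first by case: touch_f.
rewrite /sd_cut iterS -/(sd_cut n Y u).
have [->|cut_gt0] := posnP (sd_cut n Y u); first by rewrite !psum0.
apply: (proj1 (sd_next_level _ IHu)).
by rewrite cut_gt0 (leq_trans (sd_cut_le n Y u)) // leq_subr.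
Qed.

Lemma sdmmsa_convex_minorant (i : 'I_k) : sdmmsa n Y i = f i.
Proof.
have [u le_cut u_min] := ex_minnP (sd_cut_reaches n Y i).
case: u le_cut u_min => [|u] le_cut u_min.
  by have := leq_trans (ltn_ord i) le_cut; rewrite ltnn.
have lt_i : (i < sd_cut n Y u)%N.
  by rewrite ltnNge; apply/negP => /u_min; rewrite ltnn.
rewrite (sdmmsaE (u := u)) ?le_cut //; apply/esym.
have cut_range : (0 < sd_cut n Y u <= k)%N.
  rewrite (leq_ltn_trans _ lt_i) //=.
  by rewrite (leq_trans (sd_cut_le n Y u)) // leq_subr.
by apply: (proj2 (sd_next_level cut_range (psum_sd_cut u))); rewrite le_cut.
Qed.

End ConvexMinorant.

End Isotonic.

Theorem theorem2 (R : realType) (k : nat) (hk : (1 <= k)%N)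
    (Y : 'I_k -> R) (n : 'I_k -> nat) (hn : forall i, (0 < n i)%N)
    (mu_pava : 'I_k -> R) (hpava : pava n Y mu_pava) (i : 'I_k) :
  sdmmsa n Y i = mu_pava i.
Proof.
have [touch homo_mu] := pava_touching hn hpava (touching_minorant_refl n Y).
exact: (sdmmsa_convex_minorant hn touch homo_mu).
Qed.
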